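(* Let $\Pi=|00\rangle\langle00|+|01\rangle\langle10|+|10\rangle\langle01|+|11\rangle\langle11|$ be the two-qubit SWAP operator. Call an operator $L$ on $\mathbb{C}^2\otimes\mathbb{C}^2$ permutation invariant up to phase if $\Pi L\Pi=e^{i\nu}L$ for some $\nu\in\mathbb{R}$. Then, for the phase-locking-enforcing classes $\mathcal C_1(\varphi),\mathcal C_2(\varphi),\mathcal C_\theta(\varphi)$ defined in the context: (i) If $\varphi\in[0,2\pi)\setminus\{0,\pi\}$, no operator in $\mathcal C_1(\varphi)$, $\mathcal C_2(\varphi)$ or $\mathcal C_\theta(\varphi)$ (any $\theta\in(-\frac\pi2,0)\cup(0,\frac\pi2)$) is permutation invariant up to phase. (ii) If $\varphi\in\{0,\pi\}$, no operator in $\mathcal C_\theta(\varphi)$ is permutation invariant up to phase, for any $\theta\in(-\frac\pi2,0)\cup(0,\frac\pi2)$; moreover $L\mapsto\Pi L\Pi$ maps $\mathcal C_{\pi/4}(\varphi)$ into $\mathcal C_{-\pi/4}(\varphi)$ and vice versa. (iii) If $\varphi=0$, an operator in $\mathcal C_1(0)$ or in $\mathcal C_2(0)$ is permutation invariant up to phase if and only if its parameters satisfy either $b=0$, or $b\neq0$ and $a=c=m=0$. (iv) If $\varphi=\pi$, every operator $L$ in $\mathcal C_1(\pi)$ or in $\mathcal C_2(\pi)$ satisfies $\Pi L\Pi=L$.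
   Context: $|ij\rangle=|i\rangle\otimes|j\rangle$; matrices are in the ordered basis $(|00\rangle,|01\rangle,|10\rangle,|11\rangle)$ of $\mathbb{C}^2\otimes\mathbb{C}^2$. $\mathcal C_1(\varphi)$: operators $T_1\begin{pmatrix} c&0&0&0\\ 0&c&0&0\\ 0&0&a&b\\ 0&0&e^{2ik}\bar b&a+me^{ik}\end{pmatrix}T_1^\dagger$, $T_1=\begin{pmatrix}1&0&0&0\\ 0&\frac1{\sqrt2}&\frac1{\sqrt2}&0\\ 0&\frac{e^{i\varphi}}{\sqrt2}&-\frac{e^{i\varphi}}{\sqrt2}&0\\ 0&0&0&1\end{pmatrix}$, with $a,b\in\mathbb{C}$, $c,k,m\in\mathbb{R}$, and $b\neq0$ or ($a\neq c$ and $m\neq0$). $\mathcal C_2(\varphi)$: operators $T_2\begin{pmatrix} a&b&0&0\\ e^{2ik}\bar b&a+me^{ik}&0&0\\ 0&0&c&0\\ 0&0&0&c\end{pmatrix}T_2^\dagger$, $T_2=\begin{pmatrix}1&0&0&0\\ 0&\frac1{\sqrt2}&\frac1{\sqrt2}&0\\ 0&-\frac{e^{i\varphi}}{\sqrt2}&\frac{e^{i\varphi}}{\sqrt2}&0\\ 0&0&0&1\end{pmatrix}$, with $a,b\in\mathbb{C}$, $c,k,m\in\mathbb{R}$, and $b\neq0$ or ($a+me^{ik}\neq c$ and $m\neq0$). $\mathcal C_\theta(\varphi)$: operators $T_\theta\begin{pmatrix} a&b&0&0\\ e^{2ik}\bar b&a+me^{ik}&0&0\\ 0&0&a&e^{-2i\theta}b\\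 0&0&e^{2i\theta}e^{2ik}\bar b&a+me^{ik}\end{pmatrix}T_\theta^\dagger$, $T_\theta=\begin{pmatrix}1&0&0&0\\ 0&ie^{-i\varphi}\sin\theta&\cos\theta&0\\ 0&-\cos\theta&-ie^{i\varphi}\sin\theta&0\\ 0&0&0&1\end{pmatrix}$, with $a,b\in\mathbb{C}$, $b\neq0$, $k,m\in\mathbb{R}$. *)

(* Defs.v *)
From mathcomp Require Import all_boot all_order all_algebra.
From mathcomp Require Import all_classical all_reals all_analysis.
From mathcomp Require Export complex.
From mathcomp Require mxtens.

Set Implicit Arguments.
Unset Strict Implicit.
Unset Printing Implicit Defensive.

Import Order.TTheory GRing.Theory Num.Theory.

Local Open Scope classical_set_scope.
Local Open Scope sesquilinear_scope.
Local Open Scope complex_scope.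
Local Open Scope ring_scope.

(* Operators on C^2 (x) C^2 are 4 x 4 matrices over R[i].  The Kronecker product
   orders the basis as |00>, |01>, |10>, |11>, and A ^t* is the adjoint of A. *)

Section TwoQubits.
Variable R : realType.
Local Notation C := (R[i]).

Definition expi (x : R) : C := (cos x +i* sin x)%C.

Definition mx4 (rows : seq (seq C)) : 'M[C]_4 :=
  \matrix_(i < 4, j < 4) nth 0 (nth [::] rows i) j.

Definition ket (i j : 'I_2) : 'cV[C]_4 :=
  mxtens.tensmx (delta_mx i 0 : 'cV[C]_2) (delta_mx j 0 : 'cV[C]_2).

Definition SWAP : 'M[C]_4 :=
  ket 0 0 *m (ket 0 0)^t* + ket 0 1 *m (ket 1 0)^t*
  + ket 1 0 *m (ket 0 1)^t* + ket 1 1 *m (ket 1 1)^t*.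

Definition perm_inv_up_to_phase (L : 'M[C]_4) : Prop :=
  exists nu : R, SWAP *m L *m SWAP = expi nu *: L.

Definition isqrt2 : C := ((Num.sqrt 2)^-1)%:C.

Definition T1 (phi : R) : 'M[C]_4 := mx4
  [:: [:: 1; 0;                  0;                    0];
      [:: 0; isqrt2;             isqrt2;               0];
      [:: 0; expi phi * isqrt2;  - (expi phi * isqrt2); 0];
      [:: 0; 0;                  0;                    1]].

Definition op1 (phi : R) (a b : C) (c k m : R) : 'M[C]_4 :=
  T1 phi *m
  mx4 [:: [:: c%:C; 0;    0;                   0];
          [:: 0;    c%:C; 0;                   0];
          [:: 0;    0;    a;                   b];
          [:: 0;    0;    expi (2 * k) * b^*;  a + m%:C * expi k]]
  *m (T1 phi)^t*.

Definition adm1 (a b : C) (c k m : R) : Prop :=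
  b != 0 \/ (a != c%:C /\ m != 0).

Definition C1 (phi : R) : set 'M[C]_4 :=
  [set L | exists (a b : C) (c k m : R),
             adm1 a b c k m /\ L = op1 phi a b c k m].

Definition T2 (phi : R) : 'M[C]_4 := mx4
  [:: [:: 1; 0;                     0;                  0];
      [:: 0; isqrt2;                isqrt2;             0];
      [:: 0; - (expi phi * isqrt2); expi phi * isqrt2;  0];
      [:: 0; 0;                     0;                  1]].

Definition op2 (phi : R) (a b : C) (c k m : R) : 'M[C]_4 :=
  T2 phi *m
  mx4 [:: [:: a;                   b;                  0;    0];
          [:: expi (2 * k) * b^*;  a + m%:C * expi k;  0;    0];
          [:: 0;                   0;                  c%:C; 0];
          [:: 0;                   0;                  0;    c%:C]]
  *m (T2 phi)^t*.

Definition adm2 (a b : C) (c k m : R) : Prop :=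
  b != 0 \/ (a + m%:C * expi k != c%:C /\ m != 0).

Definition C2 (phi : R) : set 'M[C]_4 :=
  [set L | exists (a b : C) (c k m : R),
             adm2 a b c k m /\ L = op2 phi a b c k m].

Definition Ttheta (theta phi : R) : 'M[C]_4 := mx4
  [:: [:: 1; 0;                                    0;  0];
      [:: 0; 'i%C * expi (- phi) * (sin theta)%:C; (cos theta)%:C;  0];
      [:: 0; - (cos theta)%:C; - ('i%C * expi phi * (sin theta)%:C);  0];
      [:: 0; 0;                                    0;  1]].

Definition optheta (theta phi : R) (a b : C) (k m : R) : 'M[C]_4 :=
  Ttheta theta phi *m
  mx4 [:: [:: a;                   b;                  0; 0];
          [:: expi (2 * k) * b^*;  a + m%:C * expi k;  0; 0];
          [:: 0; 0; a;                               expi (- (2 * theta)) * b];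
          [:: 0; 0; expi (2 * theta) * expi (2 * k) * b^*; a + m%:C * expi k]]
  *m (Ttheta theta phi)^t*.

Definition Ctheta (theta phi : R) : set 'M[C]_4 :=
  [set L | exists (a b : C) (k m : R),
             b != 0 /\ L = optheta theta phi a b k m].

Definition admissible_theta (theta : R) : Prop :=
  - (pi / 2) < theta < pi / 2 /\ theta != 0.

End TwoQubits.

(* Main.v *)
Require Import Defs.
From mathcomp Require Import all_boot all_order all_algebra.
From mathcomp Require Import all_classical all_reals all_analysis.
From mathcomp Require Import ring.
Import Order.TTheory GRing.Theory Num.Theory.
Local Open Scope classical_set_scope.
Local Open Scope complex_scope.
Local Open Scope ring_scope.

Set Implicit Arguments.
Unset Strict Implicit.

(** Conjugating by SWAP exchanges the two middle rows of each frame T, so all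
   entries of [SWAP L SWAP = w L] can be read off at once.  With [e = expi phi],
   the frame of C_1(phi) gives either [w = -e] with [e^2 = 1] (when [b != 0]) or
   [w = e^2] with [w^2 = 1]; the alternative [w = -1] in the second case forces
   [c = a = 0].  Since T_2(phi) is T_1(phi + pi), the class C_2 is the same frame
   with [e] replaced by [-e].  For C_theta, comparing one entry coming from each
   2 x 2 block gives [i e sin theta = - i e sin theta], which is impossible. *)

Section TwoQubits.
Variable R : realType.
Implicit Types (a b c d p q r u w : R[i]) (x y phi theta : R).

(** * Phases and the constant [isqrt2] *)

Lemma conj_real x : (x%:C)^* = x%:C :> R[i].
Proof. exact: conjc_real. Qed.

Lemma conj_imag : ('i%C : R[i])^* = - 'i%C.
Proof. by apply/eqP; rewrite eq_complex /= oppr0 !eqxx. Qed.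

Lemma conj_expi x : (expi x)^* = expi (- x) :> R[i].
Proof. by rewrite /expi cosN sinN. Qed.

Lemma expiD x y : expi (x + y) = expi x * expi y :> R[i].
Proof.
by apply/eqP; rewrite eq_complex /= cosD sinD; apply/andP; split; apply/eqP; ring.
Qed.

Lemma expi0 : expi 0 = 1 :> R[i].
Proof. by rewrite /expi cos0 sin0. Qed.

Lemma expipi : expi pi = -1 :> R[i].
Proof. by apply/eqP; rewrite eq_complex /= cospi sinpi oppr0 !eqxx. Qed.

Lemma expi_pihalf : expi (pi / 2) = 'i%C :> R[i].
Proof. by rewrite /expi cos_pihalf sin_pihalf. Qed.

Lemma expiV x : expi (- x) * expi x = 1 :> R[i].
Proof. by rewrite -expiD addNr expi0. Qed.

Lemma isqrt2_sqr : isqrt2 R * isqrt2 R = 2^-1.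
Proof.
rewrite /isqrt2 -rmorphM -invfM -expr2 sqr_sqrtr ?ler0n //.
by rewrite fmorphV rmorph_nat.
Qed.

Lemma isqrt2_neq0 : isqrt2 R != 0.
Proof.
apply/eqP => s0; have /eqP := isqrt2_sqr.
by rewrite s0 mul0r eq_sym invr_eq0 pnatr_eq0.
Qed.

(** * Frames, block matrices and conjugation by SWAP *)

Definition frame p q r u : 'M[R[i]]_4 := mx4
  [:: [:: 1; 0; 0; 0]; [:: 0; p; r; 0]; [:: 0; q; u; 0]; [:: 0; 0; 0; 1]].

(** All eight entries are free, so one shape serves the three classes and is stable under scaling
    and sign changes. *)
Definition blocks a b b' d f g g' h : 'M[R[i]]_4 := mx4
  [:: [:: a; b; 0; 0]; [:: b'; d; 0; 0]; [:: 0; 0; f; g]; [:: 0; 0; g'; h]].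

Definition conj_frame p q r u (M : 'M[R[i]]_4) :=
  frame p q r u *m M *m map_mx Num.conj (frame p q r u)^T.

Ltac mx4_entries :=
  apply/matrixP => -[[|[|[|[|//]]]] ?] -[[|[|[|[|//]]]] ?];
  rewrite /= ?(mxE, big_ord_recl, big_ord0) /= ?(mxE, big_ord_recl, big_ord0) /=.

Lemma frame_blocksE p q r u a b b' d f g g' h :
  conj_frame p q r u (blocks a b b' d f g g' h) = mx4
  [:: [:: a; b * p^*; b * q^*; 0];
      [:: p * b'; p * d * p^* + r * f * r^*; p * d * q^* + r * f * u^*; r * g];
      [:: q * b'; q * d * p^* + u * f * r^*; q * d * q^* + u * f * u^*; u * g];
      [:: 0; g' * r^*; g' * u^*; h]].
Proof.
rewrite /conj_frame; mx4_entries; rewrite ?rmorph0 ?rmorph1; ring.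
Qed.

Lemma SWAP_mx4 : SWAP R = mx4
  [:: [:: 1; 0; 0; 0]; [:: 0; 0; 1; 0]; [:: 0; 1; 0; 0]; [:: 0; 0; 0; 1]].
Proof.
rewrite /SWAP /ket /mxtens.tensmx; mx4_entries.
all: rewrite ?(eqE, rmorph0, rmorph1) /=.
all: rewrite ?(mulr0, mul0r, mulr1, rmorph0, rmorph1, addr0, add0r) //.
Qed.

(** SWAP is absorbed into the frame and leaves [M] alone: invariance becomes a comparison of two
    frames around the same matrix. *)
Lemma SWAP_conj_frame p q r u (M : 'M[R[i]]_4) :
  SWAP R *m conj_frame p q r u M *m SWAP R = conj_frame q p u r M.
Proof.
have SF : SWAP R *m frame p q r u = frame q p u r.
  by rewrite SWAP_mx4; mx4_entries; ring.
have FS : map_mx Num.conj (frame p q r u)^T *m SWAP R =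
    map_mx Num.conj (frame q p u r)^T.
  by rewrite SWAP_mx4; mx4_entries; rewrite ?rmorph0 ?rmorph1; ring.
by rewrite /conj_frame !mulmxA SF -mulmxA FS.
Qed.

Lemma opthetaE theta phi a b (k m : R) : optheta theta phi a b k m =
  conj_frame ('i%C * expi (- phi) * (sin theta)%:C) (- (cos theta)%:C)
     (cos theta)%:C (- ('i%C * expi phi * (sin theta)%:C))
    (blocks a b (expi (2 * k) * b^*) (a + m%:C * expi k)
      a (expi (- (2 * theta)) * b) (expi (2 * theta) * expi (2 * k) * b^*)
      (a + m%:C * expi k)).
Proof. by []. Qed.

Lemma phase_entries p q r u a b b' d f g g' h w :
  conj_frame q p u r (blocks a b b' d f g g' h) =
    w *: conj_frame p q r u (blocks a b b' d f g g' h) ->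
  [/\ a = w * a, h = w * h,
      b * q^* = w * (b * p^*) /\ b * p^* = w * (b * q^*),
      u * g = w * (r * g) /\ r * g = w * (u * g)
    & [/\ q * d * q^* + u * f * u^* = w * (p * d * p^* + r * f * r^*),
          q * d * p^* + u * f * r^* = w * (p * d * q^* + r * f * u^*)
        & p * d * q^* + r * f * u^* = w * (q * d * p^* + u * f * r^*)]].
Proof.
rewrite !frame_blocksE => E.
(* [inord] falls back to 0 out of range; the indices used are at most 3. *)
pose o k : 'I_4 := inord k.
have e k l := congr1 (fun A : 'M[R[i]]_4 => A (o k) (o l)) E.
move: (e 0 0)%N (e 3 3)%N (e 0 1)%N (e 0 2)%N (e 1 3)%N (e 2 3)%N
  (e 1 1)%N (e 1 2)%N (e 2 1)%N.
by rewrite !mxE !inordK //=.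
Qed.

Lemma expi_neq0 x : expi x != 0 :> R[i].
Proof.
by apply/eqP => e0; have /eqP := expiV x; rewrite e0 mulr0 eq_sym oner_eq0.
Qed.

Lemma eq_opp0 w : w = - w -> w = 0.
Proof.
move=> ww; apply/eqP.
by rewrite -(eqr_pMn2r (n := 2)) // mulr2n {1}ww addNr mul0rn.
Qed.


(** * The classes C_1 and C_2: middle columns [(1, e)] and [(1, -e)] over sqrt 2 *)

Definition pair_frame e (M : 'M[R[i]]_4) :=
  conj_frame (isqrt2 R) (e * isqrt2 R) (isqrt2 R) (- (e * isqrt2 R)) M.

Lemma conj_isqrt2 : (isqrt2 R)^* = isqrt2 R.
Proof. exact: conj_real. Qed.

(** As [e] has modulus 1, the middle diagonal entry is [(d + f) / 2]. The entries in [b] give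
    [e^* = w] and [1 = w * e^*]; those in [g] give [w = - e] and [1 = - (w * e)]; the middle
    off-diagonal ones, proportional to [d - f], give [e = w * e^*] and [e^* = w * e]. *)
Lemma pair_frame_phase e a b b' d f g g' h w : e^* * e = 1 ->
  SWAP R *m pair_frame e (blocks a b b' d f g g' h) *m SWAP R =
    w *: pair_frame e (blocks a b b' d f g g' h) ->
  [/\ [/\ a = w * a, h = w * h & d + f = w * (d + f)],
      b != 0 -> w = e /\ e * e = 1,
      g != 0 -> w = - e /\ e * e = 1
    & d != f -> w = e * e /\ w * w = 1].
Proof.
rewrite /pair_frame SWAP_conj_frame => ee.
case/phase_entries => [aw hw [b1 b2] [g1 g2] [m1 m2 m3]].
have s0 := isqrt2_neq0.
move: m1 m2 m3 b1 b2 g1 g2; rewrite !rmorphN !rmorphM /= conj_isqrt2.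
move: (isqrt2 R) s0 => s s0 m1 m2 m3 b1 b2 g1 g2; split.
- split=> //; apply: (mulfI s0); apply: (mulfI s0).
  transitivity (e * s * d * (e^* * s) + - (e * s) * f * - (e^* * s)); first by ring: ee.
  by rewrite m1; ring.
- move=> b0; have sb : s * b != 0 by rewrite mulf_neq0.
  have we : e^* = w.
    by apply: (mulfI sb); transitivity (b * (e^* * s)); [ring|rewrite b1; ring].
  have {}b2 : 1 = w * e^*.
    by apply: (mulfI sb); transitivity (b * s); [ring|rewrite b2; ring].
  have e1 : e = w by rewrite -[LHS]mulr1 b2 mulrC -mulrA ee mulr1.
  by split; [rewrite e1|rewrite {1}e1 -we ee].
- move=> g0; have sg : s * g != 0 by rewrite mulf_neq0.
  have we : w = - e.
    by apply: (mulfI sg); transitivity (w * (s * g)); [ring|rewrite -g1; ring].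
  by split=> //; apply: (mulfI sg); rewrite mulr1 [RHS]g2 we; ring.
- rewrite -subr_eq0 => df0.
  have sdf : s * s * (d - f) != 0 by rewrite !mulf_neq0.
  have {}m2 : e = w * e^*.
    apply: (mulfI sdf); transitivity (e * s * d * s + - (e * s) * f * s); first by ring.
    by rewrite m2; ring.
  have {}m3 : e^* = w * e.
    apply: (mulfI sdf); transitivity (s * d * (e^* * s) + s * f * - (e^* * s)).
      by ring.
    by rewrite m3; ring.
  have we : w = e * e by rewrite [in X in _ = X * _]m2 -mulrA ee mulr1.
  by split=> //; rewrite {2}we mulrA -m3 ee.
Qed.

(** Only [d != f] with [w = -1] remains to be excluded: it forces [a = h = 0] and [d + f = 0], so
    [a = d] or [h = f] makes both [d] and [f] vanish. *)
Lemma pair_frame_sqr e a b b' d f g g' h w : e^* * e = 1 ->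
  [\/ b != 0, g != 0 | d != f] -> a = d \/ h = f ->
  SWAP R *m pair_frame e (blocks a b b' d f g g' h) *m SWAP R =
    w *: pair_frame e (blocks a b b' d f g g' h) ->
  e * e = 1.
Proof.
move=> ee H ad /(pair_frame_phase ee) [[aw hw mw] bP gP dP].
case: H => [/bP[]|/gP[]|df] //.
have [we /eqP] := dP df; rewrite -expr2 sqrf_eq1 => /orP[] /eqP w1; first by rewrite -we.
move: aw hw mw; rewrite w1 !mulN1r => /eq_opp0 a0 /eq_opp0 h0 /eq_opp0 /eqP.
rewrite addr_eq0 => dNf; case: ad => E; move: df dNf; rewrite -E ?a0 ?h0 ?oppr0.
  by rewrite eq_sym -eqr_oppLR oppr0 eq_sym => /negbTE ->.
by move=> /negbTE ->.
Qed.

(** For real [e] the middle columns are eigenvectors of SWAP with eigenvalues [e] and [- e], so SWAP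
    acts on the block matrix as conjugation by diag(1, e, -e, 1). *)
Lemma pair_frame_swap e a b b' d f g g' h : e = 1 \/ e = -1 ->
  SWAP R *m pair_frame e (blocks a b b' d f g g' h) *m SWAP R =
  pair_frame e (blocks a (e * b) (e * b') d f (- (e * g)) (- (e * g')) h).
Proof.
move=> e1; rewrite /pair_frame SWAP_conj_frame !frame_blocksE.
have ec : e^* = e by case: e1 => ->; rewrite ?rmorphN rmorph1.
have ee : e * e = 1 by case: e1 => ->; rewrite ?mulrNN mulr1.
rewrite !rmorphN !rmorphM /= conj_isqrt2 ec.
by apply/matrixP => -[[|[|[|[|//]]]] ?] -[[|[|[|[|//]]]] ?];
  rewrite !mxE /=; ring: ee.
Qed.

Lemma pair_frameZ e w (M : 'M[R[i]]_4) : pair_frame e (w *: M) = w *: pair_frame e M.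
Proof. by rewrite /pair_frame /conj_frame -scalemxAr -scalemxAl. Qed.

Lemma scale_blocks w a b b' d f g g' h :
  w *: blocks a b b' d f g g' h =
  blocks (w * a) (w * b) (w * b') (w * d) (w * f) (w * g) (w * g') (w * h).
Proof.
by apply/matrixP => -[[|[|[|[|//]]]] ?] -[[|[|[|[|//]]]] ?]; rewrite !mxE /= ?mulr0.
Qed.

Lemma op1E phi a b (c k m : R) : op1 phi a b c k m =
  pair_frame (expi phi)
    (blocks c%:C 0 0 c%:C a b (expi (2 * k) * b^*) (a + m%:C * expi k)).
Proof. by []. Qed.

Lemma op2E phi a b (c k m : R) : op2 phi a b c k m =
  pair_frame (- expi phi)
    (blocks a b (expi (2 * k) * b^*) (a + m%:C * expi k) c%:C 0 0 c%:C).
Proof. by rewrite /pair_frame mulNr opprK. Qed.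

Lemma conj_expiK phi : (expi phi)^* * expi phi = 1 :> R[i].
Proof. by rewrite conj_expi expiV. Qed.

(** A phase with square 1 is real, and on [0, 2 pi) the sine vanishes only at 0 and pi. *)
Lemma expi_sqr_eq1 phi : 0 <= phi < 2 * pi -> phi != 0 -> phi != pi ->
  expi phi * expi phi != 1 :> R[i].
Proof.
move=> /andP[phi0 phi2] phin0 phinpi; rewrite -expr2 sqrf_eq1.
have sphi : sin phi != 0.
  have [lt|gt|/eqP] := ltgtP phi pi; last by rewrite (negbTE phinpi).
    by rewrite gt_eqF // sin_gt0_pi // lt_neqAle eq_sym phin0 phi0 lt.
  have : 0 < sin (phi - pi).
    by rewrite sin_gt0_pi // subr_gt0 gt ltrBlDr -mulr2n -mulr_natl.
  by rewrite -[X in sin X == _](subrK pi) sinDpi oppr_eq0 => /gt_eqF ->.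
by rewrite !eq_complex /= oppr0 (negbTE sphi) !andbF.
Qed.

(** * The classes C_theta *)

Lemma optheta_not_perm_inv theta phi a b (k m : R) :
  admissible_theta theta -> b != 0 ->
  ~ perm_inv_up_to_phase (optheta theta phi a b k m).
Proof.
move=> [tb t0] b0 [nu]; rewrite opthetaE SWAP_conj_frame.
(* Entry (0,2) comes from the first block and entry (1,3) from the second. *)
case/phase_entries => _ _ [_ b2] [g1 _] _.
have st : sin theta != 0.
  case/andP: tb => t1 t2; have [lt|gt|/eqP] := ltgtP theta 0; last by rewrite (negbTE t0).
    rewrite -[theta]opprK sinN oppr_eq0 gt_eqF // sin_gt0_pihalf //.
    by rewrite oppr_gt0 lt ltrNl.
  by rewrite gt_eqF // sin_gt0_pihalf // gt.
move: b2 g1; rewrite !rmorphN !rmorphM /= conj_imag conj_expi opprK !conj_real.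
have := expi_neq0 (- (2 * theta)).
have s0 : (sin theta)%:C != 0 :> R[i] by rewrite eq_complex /= (negbTE st).
have i0 : 'i%C != 0 :> R[i] by rewrite eq_complex /= oner_eq0 andbF.
have := expi_neq0 phi.
move: (expi phi) (expi (- (2 * theta))) (expi nu) s0 i0 => e E w.
move: ((sin theta)%:C) ((cos theta)%:C) 'i%C => s c I s0 I0 e0 E0 b2 g1.
have h1 : I * e * s = w * c.
  apply: (mulfI b0); apply: oppr_inj.
  by transitivity (b * (- I * e * s)); [ring|rewrite b2; ring].
(* The second block equates [w * c] with the opposite value, once [E * b] is cancelled. *)
have : I * e * s = - (I * e * s).
  rewrite {1}h1; apply: (mulfI E0); apply: (mulfI b0).
  by transitivity (w * (c * (E * b))); [ring|rewrite -g1; ring].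
by move/eq_opp0/eqP; rewrite !mulf_eq0 (negbTE I0) (negbTE e0) (negbTE s0).
Qed.

(** Let [z = (-1) ^+ sg * 'i * expi phi]. Swapping the rows of the frame at [theta] multiplies both
    middle columns of the frame at [- theta] by [z^*], hence [b] by [z]. The second block then fits
    because [expi (2 * theta) = - expi (- (2 * theta))]. *)
Lemma optheta_swap (sg : bool) theta phi a b (k m : R) :
  expi phi = 1 :> R[i] \/ expi phi = -1 :> R[i] ->
  sin theta = (-1) ^+ sg * cos theta -> expi (2 * theta) = (-1) ^+ sg * 'i%C ->
  SWAP R *m optheta theta phi a b k m *m SWAP R =
  optheta (- theta) phi a ((-1) ^+ sg * 'i%C * expi phi * b) k m.
Proof.
move=> e1 st et; rewrite !opthetaE SWAP_conj_frame !frame_blocksE.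
have eN : expi (- phi) = expi phi.
  by rewrite -conj_expi; case: e1 => ->; rewrite ?rmorphN rmorph1.
have ee : expi phi * expi phi = 1 :> R[i] by case: e1 => ->; rewrite ?mulrNN mulr1.
have etN : expi (- (2 * theta)) = - ((-1) ^+ sg * 'i%C).
  by rewrite -conj_expi et rmorphM rmorphXn rmorphN1 /= conj_imag mulrN.
rewrite mulrN opprK etN et cosN sinN st !(rmorphN, rmorphM) /=.
rewrite conj_imag !conj_real eN conj_expi eN.
rewrite !rmorphXn !rmorphN1 /=.
have ii : 'i%C * 'i%C = -1 :> R[i] by rewrite -expr2 sqr_i.
move: ((cos theta)%:C) (expi (2 * k)) (m%:C * expi k) (b^*) (expi phi) 'i%C ee ii
  => ct K M B e I ee ii.
clear st et etN; case: sg => /=; rewrite ?expr1 ?expr0;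
by apply/matrixP => -[[|[|[|[|//]]]] ?] -[[|[|[|[|//]]]] ?];
  rewrite !mxE /=; ring: ee ii.
Qed.

Lemma sin_cos_pi4 : sin (pi / 4) = cos (pi / 4) :> R /\ 2 * (pi / 4) = pi / 2 :> R.
Proof.
have E : 2 * (pi / 4) = pi / 2 :> R by field.
split=> //; rewrite -cosBpihalf -E -cosN; congr cos; ring.
Qed.


(** * Back to the parameters of the classes *)

Lemma op1_perm_inv_sqr phi a b (c k m : R) : adm1 a b c k m ->
  perm_inv_up_to_phase (op1 phi a b c k m) -> expi phi * expi phi = 1 :> R[i].
Proof.
move=> adm [nu]; rewrite op1E; apply: pair_frame_sqr; [exact: conj_expiK| |by left].
(* In [op1] the scalar block comes first, so [b] sits in slot [g] and [a] in slot [f]. *)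
by case: adm => [b0|[ac _]]; [constructor 2|constructor 3; rewrite eq_sym].
Qed.

Lemma op2_perm_inv_sqr phi a b (c k m : R) : adm2 a b c k m ->
  perm_inv_up_to_phase (op2 phi a b c k m) -> expi phi * expi phi = 1 :> R[i].
Proof.
move=> adm [nu]; rewrite op2E => /pair_frame_sqr H; rewrite -mulrNN; apply: H.
- by rewrite rmorphN mulrNN conj_expiK.
- by case: adm => [b0|[dc _]]; [constructor 1|constructor 3].
- by right.
Qed.

Lemma real_expi_eq0 (k m : R) : m%:C * expi k = 0 -> m = 0.
Proof. by move/eqP; rewrite mulf_eq0 (negbTE (expi_neq0 k)) orbF => /eqP[]. Qed.

(** Here [e = 1], so SWAP negates [b] and fixes the diagonal. If [b != 0] the phase is -1, which
    kills the diagonal. *)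
Lemma op1_0_perm_inv a b (c k m : R) :
  perm_inv_up_to_phase (op1 0 a b c k m) <->
  b = 0 \/ (b != 0 /\ [/\ a = 0, c = 0 & m = 0]).
Proof.
rewrite op1E expi0; split=> [[nu H]|[->|[b0 [-> -> ->]]]].
- have [->|b0] := eqVneq b 0; [by left|right; split=> //].
  have [|[cw hw mw] _ /(_ b0)[wE _] _] := pair_frame_phase _ H.
    by rewrite rmorph1 mulr1.
  move: cw hw mw; rewrite wE !mulN1r => /eq_opp0 c0 /eq_opp0 h0 /eq_opp0.
  rewrite c0 add0r => a0; move: h0; rewrite a0 add0r => /real_expi_eq0 ->.
  by split=> //; case: c0.
- exists 0; rewrite pair_frame_swap; last by left.
  by rewrite expi0 scale1r rmorph0 !mulr0 oppr0.
(* Only the off-diagonal entries survive, and SWAP negates them: the phase is [expi pi]. *)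
- exists pi; rewrite pair_frame_swap; last by left.
  by rewrite expipi -pair_frameZ scale_blocks !mulN1r !mul1r mul0r addr0 !oppr0.
Qed.

(** Now [e = -1] and [b] lies in the first block, so SWAP again negates it. *)
Lemma op2_0_perm_inv a b (c k m : R) :
  perm_inv_up_to_phase (op2 0 a b c k m) <->
  b = 0 \/ (b != 0 /\ [/\ a = 0, c = 0 & m = 0]).
Proof.
rewrite op2E expi0; split=> [[nu H]|[->|[b0 [-> -> ->]]]].
- have [->|b0] := eqVneq b 0; [by left|right; split=> //].
  have [|[aw hw mw] /(_ b0)[wE _] _ _] := pair_frame_phase _ H.
    by rewrite rmorphN1 mulrNN mulr1.
  move: aw hw mw; rewrite wE !mulN1r => /eq_opp0 a0 /eq_opp0 c0 /eq_opp0.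
  rewrite c0 a0 addr0 add0r => /real_expi_eq0 ->.
  by split=> //; case: c0.
- exists 0; rewrite pair_frame_swap; last by right.
  by rewrite expi0 scale1r rmorph0 !mulr0 oppr0.
- exists pi; rewrite pair_frame_swap; last by right.
  by rewrite expipi -pair_frameZ scale_blocks !mulN1r mul0r addr0 !oppr0.
Qed.

Lemma Ctheta_swap (sg : bool) theta phi L : phi = 0 \/ phi = pi ->
  sin theta = (-1) ^+ sg * cos theta -> expi (2 * theta) = (-1) ^+ sg * 'i%C ->
  Ctheta theta phi L -> Ctheta (- theta) phi (SWAP R *m L *m SWAP R).
Proof.
move=> phiE st et [a [b [k [m [b0 ->]]]]].
(* Only [b] changes, by a unit factor, so it stays nonzero. *)
exists a, ((-1) ^+ sg * 'i%C * expi phi * b), k, m; split; last first.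
  apply: optheta_swap => //.
  by case: phiE => ->; rewrite ?expi0 ?expipi; [left|right].
by rewrite !mulf_neq0 ?signr_eq0 ?expi_neq0 // eq_complex /= oner_eq0 andbF.
Qed.

End TwoQubits.

Theorem mainTheorem11 (R : realType) :
  (* (i) *)
  (forall phi : R, 0 <= phi < 2 * pi -> phi != 0 -> phi != pi ->
     [/\ (forall L, C1 phi L -> ~ perm_inv_up_to_phase L),
         (forall L, C2 phi L -> ~ perm_inv_up_to_phase L)
       & (forall theta : R, admissible_theta theta ->
            forall L, Ctheta theta phi L -> ~ perm_inv_up_to_phase L)])
  /\
  (* (ii) *)
  (forall phi : R, phi = 0 \/ phi = pi ->
     [/\ (forall theta : R, admissible_theta theta ->
            forall L, Ctheta theta phi L -> ~ perm_inv_up_to_phase L),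
         (forall L, Ctheta (pi / 4) phi L ->
            Ctheta (- (pi / 4)) phi (SWAP R *m L *m SWAP R))
       & (forall L, Ctheta (- (pi / 4)) phi L ->
            Ctheta (pi / 4) phi (SWAP R *m L *m SWAP R))])
  /\
  (* (iii) *)
  ((forall (a b : R[i]) (c k m : R), adm1 a b c k m ->
      (perm_inv_up_to_phase (op1 0 a b c k m) <->
         b = 0 \/ (b != 0 /\ [/\ a = 0, c = 0 & m = 0])))
   /\
   (forall (a b : R[i]) (c k m : R), adm2 a b c k m ->
      (perm_inv_up_to_phase (op2 0 a b c k m) <->
         b = 0 \/ (b != 0 /\ [/\ a = 0, c = 0 & m = 0]))))
  /\
  (* (iv) *)
  ((forall L, C1 pi L -> SWAP R *m L *m SWAP R = L)
   /\
   (forall L, C2 pi L -> SWAP R *m L *m SWAP R = L)).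
Proof.
have opt theta phi L : admissible_theta theta ->
    Ctheta theta phi L -> ~ perm_inv_up_to_phase L.
  by move=> th [a [b [k [m [b0 ->]]]]]; exact: optheta_not_perm_inv.
split; [|split; [|split]].
- move=> phi phi_dom phi0 phipi; have /eqP e2 := expi_sqr_eq1 phi_dom phi0 phipi.
  split=> [L [a [b [c [k [m [adm ->]]]]]]|L [a [b [c [k [m [adm ->]]]]]]|].
  - by move/(op1_perm_inv_sqr adm).
  - by move/(op2_perm_inv_sqr adm).
  - by move=> theta th L; exact: opt.
- move=> phi phiE; have [sc dbl] := sin_cos_pi4 R.
  split=> [theta th L|L|L]; first exact: opt.
    by apply: (@Ctheta_swap R false); rewrite ?mul1r // dbl expi_pihalf.
  (* Writing [pi / 4] as a double opposite lets [Ctheta_swap] apply at [- (pi / 4)], where sine and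
     cosine have opposite signs. *)
  rewrite -[X in _ -> Ctheta X _ _]opprK.
  apply: (@Ctheta_swap R true) => //; rewrite ?expr1 ?mulN1r ?cosN ?sinN ?sc //.
  by rewrite mulrN -conj_expi dbl expi_pihalf conj_imag.
- by split=> a b c k m _; [exact: op1_0_perm_inv|exact: op2_0_perm_inv].
(* At [pi], [e] is -1 for C_1 and 1 for C_2; in both cases the block holding [b] gets the factor
   1. *)
- split=> L [a [b [c [k [m [_ ->]]]]]].
    rewrite op1E expipi pair_frame_swap; last by right.
    by rewrite !mulN1r !opprK !oppr0.
  rewrite op2E expipi opprK pair_frame_swap; last by left.
  by rewrite !mul1r !oppr0.
Qed.
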